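(* Let $n,m,s\ge 2$, let $G_1=B(n,m,s)$ be the double broom graph on the vertex set $V(G_1)=\{x_1,\ldots,x_n,y_1,\ldots,y_m,z_1,\ldots,z_s\}$, and let $NI(G_1^2)\subset S=K[V(G_1)]$ be the closed neighborhood ideal of the square of $G_1$. Then the height of $NI(G_1^2)$ is $$\operatorname{ht} NI(G_1^2)=\left\lceil\frac{m+2}{5}\right\rceil.$$
   Context: $K$ is a field. For $n,m,s\ge 2$, the double broom graph $G_1=B(n,m,s)$ is the simple graph with vertex set $V(G_1)=\{x_1,\ldots,x_n,y_1,\ldots,y_m,z_1,\ldots,z_s\}$ and edge set $E(G_1)=\{\{x_i,y_1\}:1\le i\le n\}\cup\{\{y_j,y_{j+1}\}:1\le j\le m-1\}\cup\{\{y_m,z_r\}:1\le r\le s\}$. Its square $G_1^2$ is the graph on the same vertex set with edge set $E(G_1^2)=E(G_1)\cup\{\{x_i,x_j\}:1\le i<j\le n\}\cup\{\{x_i,y_2\}:1\le i\le n\}\cup\{\{y_j,y_{j+2}\}:1\le j\le m-2\}\cup\{\{y_{m-1},z_r\}:1\le r\le s\}\cup\{\{z_r,z_h\}:1\le r<h\le s\}$. For a simple graph $H$ and a vertex $u$, the closed neighborhood is $N[u]=\{u\}\cup\{v:\{u,v\}\in E(H)\}$. The closed neighborhood ideal $NI(H)$ is the squarefree monomial ideal of the polynomial ring $K[V(H)]$ (whose variables are the vertices) generated by the monomials $\prod_{v\in N[u]}v$, for $u\in V(H)$. *)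

(* Defs.v *)
From HB Require Import structures.
From mathcomp Require Import all_boot all_order all_algebra.
From mathcomp Require Import boolp.
From mathcomp Require Export mpoly ring_quotient.
From mathcomp Require Import zify.

Set Implicit Arguments.
Unset Strict Implicit.
Unset Printing Implicit Defensive.

Import GRing.Theory.
Local Open Scope ring_scope.

Section Height.
Variable R : comNzRingType.

(* Subsets of R are elements of {pred R}; boolp makes every Prop-valued
   predicate a boolean one, so this does not restrict to decidable subsets. *)

Definition ideal_span (I : finType) (g : I -> R) : {pred R} :=
  [pred f | `[< exists c : I -> R, f = \sum_(i : I) c i * g i >] ].

(* idealr_closed includes properness (1 \notin P). *)
Definition prime_ideal (P : {pred R}) : Prop :=
  idealr_closed P /\ prime_idealr_closed P.

Definition strict_subset (P Q : {pred R}) : Prop :=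
  {subset P <= Q} /\ exists2 f, f \in Q & f \notin P.

(* P_0 < P_1 < ... < P_l = P: the length l counts the strict inclusions. *)
Definition prime_chain (P : {pred R}) (l : nat) : Prop :=
  exists c : nat -> {pred R},
    [/\ forall i, (i <= l)%N -> prime_ideal (c i),
        forall i, (i < l)%N -> strict_subset (c i) (c i.+1)
      & c l =i P].

Definition prime_height_is (P : {pred R}) (h : nat) : Prop :=
  prime_chain P h /\ forall l, prime_chain P l -> (l <= h)%N.

(* ht I = h, the minimum of ht P over the primes P containing I.  Primes of
   infinite height satisfy prime_height_is for no h and so do not affect the
   minimum. *)
Definition height_is (I : {pred R}) (h : nat) : Prop :=
  (exists P : {pred R},
     [/\ prime_ideal P, {subset I <= P} & prime_height_is P h]) /\
  (forall (P : {pred R}) (k : nat),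
     prime_ideal P -> {subset I <= P} -> prime_height_is P k -> (h <= k)%N).

Lemma height_is_uniq (I : {pred R}) (h k : nat) :
  height_is I h -> height_is I k -> h = k.
Proof.
move=> [[P [Pp IP Ph]] hmin] [[Q [Qp IQ Qk]] kmin].
by apply/eqP; rewrite eqn_leq (hmin _ _ Qp IQ Qk) (kmin _ _ Pp IP Ph).
Qed.

End Height.

Section Graphs.
Variable V : finType.

Definition graph_square (e : rel V) : rel V :=
  fun u v => (u != v) && (e u v || [exists w, e u w && e w v]).

Definition closed_nbhd (e : rel V) (u : V) : {set V} :=
  u |: [set v | e u v].

Variable K : fieldType.

(* K[V] is {mpoly K[#|V|]}, with variables indexed through enum_rank. *)
Definition vertex_var (v : V) : {mpoly K[#|V|]} := 'X_(enum_rank v).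

Definition closed_nbhd_ideal (e : rel V) : {pred {mpoly K[#|V|]}} :=
  ideal_span (fun u : V => \prod_(v in closed_nbhd e u) vertex_var v).

End Graphs.

Arguments closed_nbhd_ideal {V} K e.

Section DoubleBroom.
Variables n m s : nat.

(* x_{i+1} is inl (inl i), y_{j+1} is inl (inr j) and z_{r+1} is inr r. *)
Definition dbroom_vertex : finType := (('I_n + 'I_m) + 'I_s)%type.

Definition dbroom_edge (u v : dbroom_vertex) : bool :=
  match u, v with
  | inl (inl _), inl (inr j) => j == 0%N :> nat
  | inl (inr j), inl (inr k) => k == j.+1 :> nat
  | inl (inr j), inr _       => j.+1 == m
  | _, _ => false
  end.

Definition dbroom : rel dbroom_vertex :=
  fun u v => dbroom_edge u v || dbroom_edge v u.

Definition dbroom_square_edge (u v : dbroom_vertex) : bool :=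
  match u, v with
  | inl (inl i), inl (inl j) => (i < j)%N
  | inl (inl _), inl (inr j) => (j == 0%N :> nat) || (j == 1%N :> nat)
  | inl (inr j), inl (inr k) => (k == j.+1 :> nat) || (k == j.+2 :> nat)
  | inl (inr j), inr _       => (j.+1 == m) || (j.+2 == m)
  | inr r, inr h             => (r < h)%N
  | _, _ => false
  end.

Lemma dbroom_sym : ssrbool.symmetric dbroom.
Proof. by move=> u v; rewrite /dbroom orbC. Qed.

Lemma dbroom_irr : irreflexive dbroom.
Proof. by case=> [[i|j]|r] //; rewrite /dbroom /= orbb; lia. Qed.

(* The explicit list of the edges of the square of the double broom. *)
Lemma graph_square_dbroomE : (2 <= m)%N -> forall u v,
  graph_square dbroom u v = dbroom_square_edge u v || dbroom_square_edge v u.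
Proof.
move=> m2.
have yP k : (k < m)%N -> exists j : 'I_m, j = k :> nat.
  by move=> km; exists (Ordinal km).
have fwd u v : dbroom_square_edge u v -> graph_square dbroom u v.
  move=> H; apply/andP; split.
    apply: contraTneq H => ->.
    by case: v => [[i|j]|r] /=; lia.
  rewrite /dbroom; apply/orP.
  case: u v H => [[i|j]|r] [[i'|j']|r'] //= H.
  - right; apply/existsP; have [j0 E] := yP 0%N (ltnW m2).
    by exists (inl (inr j0)); rewrite /= E.
  - case/orP: H => /eqP H; first by left; rewrite H.
    right; apply/existsP; have [j0 E] := yP 0%N (ltnW m2).
    by exists (inl (inr j0)); rewrite /= E H.
  - case/orP: H => /eqP H; first by left; rewrite H eqxx.
    right; apply/existsP.
    have [|j0 E] := yP j.+1; first by have := ltn_ord j'; lia.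
    by exists (inl (inr j0)); rewrite /= E H !eqxx.
  - case/orP: H => /eqP H; first by left; rewrite H eqxx.
    right; apply/existsP; have [|j0 E] := yP j.+1; first by lia.
    by exists (inl (inr j0)); rewrite /= E H !eqxx.
  - right; apply/existsP; have [|j0 E] := yP m.-1; first by lia.
    by exists (inl (inr j0)); rewrite /= E prednK ?eqxx ?orbT //; lia.
have gsym u v : graph_square dbroom u v = graph_square dbroom v u.
  rewrite /graph_square eq_sym dbroom_sym; congr (_ && (_ || _)).
  by apply: eq_existsb => w; rewrite andbC dbroom_sym (dbroom_sym w).
move=> u v; apply/idP/idP; last first.
  by case/orP=> /fwd //; rewrite gsym.
rewrite /graph_square => /andP[neq].
have neqv (k : nat) (i j : 'I_k) : i != j -> (i < j)%N || (j < i)%N.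
  by rewrite -neq_ltn.
case/orP=> [|/existsP[w]]; rewrite /dbroom.
  move: neq; case: u => [[i|j]|r]; case: v => [[i'|j']|r'] //= _; lia.
move: neq; case: u => [[i|j]|r]; case: v => [[i'|j']|r'] //= neq;
  case: w => [[i0|j0]|r0] //=; rewrite ?orbF ?andbF //.
all: try (by move=> _; apply: neqv; apply: contraNneq neq => ->).
all: try (have : (j : nat) != j' by apply: contraNneq neq => /val_inj ->).
all: try (have := ltn_ord j); try (have := ltn_ord j');
     try (have := ltn_ord j0); lia.
Qed.

End DoubleBroom.

Arguments dbroom n m s u v : clear implicits.

(* Main.v *)
Require Import Defs.
From mathcomp Require Import all_boot all_order all_algebra.
From mathcomp Require Import zify.

(** The double broom is a path with both ends blown up: give the [x_i] the
    layer 0, [y_j] the layer [j] and the [z_r] the layer [m + 1].  Two vertices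
    of the broom are at distance at most 2 exactly when their layers differ by
    at most 2 ([mem_closed_nbhd_dbroom_square]).  The closed neighbourhoods of
    the square are thus the unions of layers in the windows [p - 2, p + 2] of a
    path of [m + 2] layers.  Vertices in the layers 2, 7, 12, ..., the last one
    capped at [m + 1], meet every window, and the windows around the layers
    0, 5, 10, ... are disjoint; both families have (m + 2) / 5 members, rounded
    up.

    It remains to turn a set [D] of [h] vertices that meets every closed
    neighbourhood, together with [h] disjoint closed neighbourhoods, into the
    height of the ideal ([height_closed_nbhd_ideal]).  A prime that contains
    the ideal contains a variable from each of the [h] disjoint neighbourhoods,
    and a prime that contains [h] distinct variables ends a chain of length [h]
    ([prime_chain_vars]), so its height is at least [h].  Conversely the prime
    generated by the variables of [D] contains the ideal, and its height is
    exactly [h] ([var_ideal_height]).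

    The upper bound in the last claim replaces Krull's height theorem by a
    dimension count.  A chain that ends at the ideal of the variables in [T]
    extends, by adding the other variables one at a time, by [N - #|T|] steps,
    so it suffices that no chain of primes in N variables is longer than N
    ([prime_chain_dim]).  Elements chosen in the successive differences of a
    chain of primes are algebraically independent ([prime_chain_alg_indep]),
    whereas N + 1 polynomials in N variables never are
    ([algebraic_dependence]). *)

Set Implicit Arguments.
Unset Strict Implicit.
Unset Printing Implicit Defensive.

Import GRing.Theory Num.Theory.
Local Open Scope ring_scope.

(** * Algebraic dependence of N + 1 polynomials in N variables *)

Lemma linear_dependence (K : fieldType) (I J : finType) (M : I -> J -> K) :
  (#|J| < #|I|)%N ->
  exists2 c : I -> K, exists i, c i != 0 & forall j, \sum_i c i * M i j = 0.
Proof.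
move=> ltJI.
pose A := \matrix_(i < #|I|, j < #|J|) M (enum_val i) (enum_val j).
have ker_neq0 : kermx A != 0.
  rewrite -mxrank_eq0 mxrank_ker subn_eq0 -ltnNge.
  exact: leq_ltn_trans (rank_leq_col A) ltJI.
have /rowV0Pn[v /sub_kermxP vA /rV0Pn[k vk]] := ker_neq0.
exists (fun i => v 0 (enum_rank i)).
  by exists (enum_val k); rewrite enum_valK.
move=> j; have /matrixP/(_ 0 (enum_rank j)) := vA.
rewrite !mxE => vAj; rewrite -[RHS]vAj (reindex enum_rank) /=; last first.
  by apply: onW_bij; exact: enum_rank_bij.
by apply: eq_bigr => i _; rewrite mxE !enum_rankK.
Qed.

Lemma msizeM_bound (K : fieldType) (N : nat) (p q : {mpoly K[N]}) (a b : nat) :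
  (msize p <= a.+1 -> msize q <= b.+1 -> msize (p * q) <= (a + b).+1)%N.
Proof.
have [->|p0] := eqVneq p 0; first by rewrite mul0r msize0.
have [->|q0] := eqVneq q 0; first by rewrite mulr0 msize0.
rewrite msizeM //; move: p0 q0; rewrite -!msize_poly_eq0.
move: (msize p) (msize q) => x y; lia.
Qed.

Lemma msize_monomial_bound (K : fieldType) (N n D B : nat)
    (f : 'I_n -> {mpoly K[N]}) (a : 'I_n -> nat) :
  (forall i, msize (f i) <= D.+1)%N -> (forall i, a i <= B)%N ->
  (msize (\prod_i f i ^+ a i) <= (n * (B * D)).+1)%N.
Proof.
move=> fD aB.
have exp_bound i k : (msize (f i ^+ k) <= (k * D).+1)%N.
  elim: k => [|k IHk]; first by rewrite expr0 msize1.
  by rewrite exprS mulSn; apply: msizeM_bound.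
suff : (msize (\prod_i f i ^+ a i) <= (\sum_(i < n) B * D).+1)%N.
  by rewrite sum_nat_const card_ord.
apply: (big_ind2 (fun p d => msize p <= d.+1)%N).
- by rewrite msize1.
- by move=> p d q e; apply: msizeM_bound.
- move=> i _; apply: leq_trans (exp_bound i (a i)) _.
  by rewrite ltnS leq_mul2r aB orbT.
Qed.

(** The products of powers of the [f i] with all exponents below B number
    B^(N+1), while their monomials have exponents below a bound that is linear
    in B, so that they lie in a space of dimension O(B^N).  For B large enough
    this forces a linear relation. *)
Lemma algebraic_dependence (K : fieldType) (N : nat)
    (f : 'I_N.+1 -> {mpoly K[N]}) :
  exists B (c : {ffun 'I_N.+1 -> 'I_B} -> K),
    (exists a, c a != 0) /\ \sum_a c a *: \prod_i f i ^+ a i = 0.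
Proof.
(* B exceeds C ^ N, which is what makes (C * B) ^ N < B ^ N.+1. *)
pose D := \max_i msize (f i); pose C := (N.+1 * D).+1; pose B := (C ^ N).+1.
pose M := (C * B)%N.
pose mon (b : {ffun 'I_N -> 'I_M}) := [multinom (b i : nat) | i < N].
have fD i : (msize (f i) <= D.+1)%N by apply: leqW; apply: leq_bigmax.
have prodM (a : {ffun 'I_N.+1 -> 'I_B}) :
    (msize (\prod_i f i ^+ a i) <= M)%N.
  apply: leq_trans (msize_monomial_bound (B := (C ^ N)%N) fD _) _.
    by move=> i; rewrite -ltnS.
  by rewrite /M /B /C; move: (C ^ N)%N => E; nia.
pose I := {ffun 'I_N.+1 -> 'I_B}; pose J := {ffun 'I_N -> 'I_M}.
have ltJI : (#|J| < #|I|)%N.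
  rewrite !card_ffun !card_ord /M expnMn [leqRHS]expnS ltn_pmul2r //.
  by rewrite expn_gt0.
have [c cn0 cM] := @linear_dependence K I J
  (fun a b => (\prod_i f i ^+ a i)@_(mon b)) ltJI.
exists B, c; split=> //; apply/mpolyP => m.
rewrite mcoeff0 raddf_sum /=.
under eq_bigr => a _ do rewrite mcoeffZ.
(* A monomial outside the box occurs in none of the products. *)
have [mM|] := boolP [forall i, m i < M]%N; last first.
  rewrite negb_forall => /existsP[i]; rewrite -leqNgt => mM.
  apply: big1 => a _; rewrite [X in _ * X]memN_msupp_eq0 ?mulr0 //.
  apply: msize_mdeg_ge; apply: leq_trans (prodM a) _; apply: leq_trans mM _.
  by rewrite mdegE (bigD1 i) //= leq_addr.
have -> : m = mon [ffun i => Ordinal (forallP mM i)].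
  by apply/mnmP => i; rewrite mnmE ffunE.
exact: cM.
Qed.

(** * Ideals and primes *)

Section Ideal.
Variables (R : comNzRingType) (P : {pred R}).
Hypothesis idealP : idealr_closed P.

Lemma ideal0 : 0 \in P. Proof. by case: idealP. Qed.

Lemma ideal1 : 1 \notin P. Proof. by case: idealP. Qed.

Lemma idealD u v : u \in P -> v \in P -> u + v \in P.
Proof. by case: idealP => _ _ PD uP vP; rewrite -[u]mul1r PD. Qed.

Lemma idealMl a u : u \in P -> a * u \in P.
Proof. by case: idealP => P0 _ PD uP; rewrite -[a * u]addr0 PD. Qed.

Lemma ideal_sum (I : Type) (r : seq I) (Q : pred I) (F : I -> R) :
  (forall i, Q i -> F i \in P) -> \sum_(i <- r | Q i) F i \in P.
Proof.
by apply: (big_ind (fun u => u \in P)); [exact: ideal0 | exact: idealD].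
Qed.

Lemma idealDl u v : v \in P -> (u + v \in P) = (u \in P).
Proof.
move=> vP; apply/idP/idP => [uvP|uP]; last exact: idealD.
by rewrite -[u](addrK v) -mulN1r idealD ?idealMl.
Qed.

Hypothesis primeP : prime_idealr_closed P.

Lemma prime_prod (I : Type) (r : seq I) (Q : pred I) (F : I -> R) :
  \prod_(i <- r | Q i) F i \in P -> exists2 i, Q i & F i \in P.
Proof.
elim: r => [|i r IHr]; first by rewrite big_nil (negPf ideal1).
by rewrite big_cons; case: ifP => // Qi /primeP/orP[FiP|/IHr//]; exists i.
Qed.

Lemma prime_exp u k : u ^+ k \in P -> u \in P.
Proof.
elim: k => [|k IHk]; first by rewrite expr0 (negPf ideal1).
by rewrite exprS => /primeP/orP[|/IHk].
Qed.

End Ideal.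

(** * Length of chains of primes *)

(** In a relation between the [f i], factor out the lowest power of [f 0]:
    since [f 0] is not in the prime [P 0], the cofactor is in [P 0], hence in
    [P 1]; as [f 0] is in [P 1], only its terms free of [f 0] matter modulo
    [P 1].  Treating [f 1], [f 2], ... in the same way leaves one nonzero
    constant in [P n], which is absurd.  The terms that survive the first [i]
    steps are recorded as a set [A] of exponents that agree below [i]. *)
Lemma prime_chain_alg_indep (K : fieldType) (R : comAlgType K) (n B : nat)
    (P : nat -> {pred R}) (f : nat -> R)
    (c : {ffun 'I_n -> 'I_B} -> K) :
  (forall i, (i <= n)%N -> prime_ideal (P i)) ->
  (forall i, (i < n)%N -> {subset P i <= P i.+1}) ->
  (forall i, (i < n)%N -> f i \in P i.+1 /\ f i \notin P i) ->
  \sum_a c a *: \prod_(i < n) f i ^+ a i = 0 -> forall a, c a = 0.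
Proof.
move=> primeP subP fP rel0 a0; apply/eqP; apply: contraT => ca0.
pose tail i (a : {ffun 'I_n -> 'I_B}) := \prod_(j < n | (i <= j)%N) f j ^+ a j.
have /(_ n (leqnn n))[A [[a aA] cA agree]] :
    forall i, (i <= n)%N -> exists A : {set {ffun 'I_n -> 'I_B}},
      [/\ exists a, a \in A, {in A, forall a, c a != 0},
          {in A &, forall a b : {ffun 'I_n -> 'I_B},
             forall j : 'I_n, (j < i)%N -> a j = b j} &
          \sum_(a in A) c a *: tail i a \in P i].
  elim=> [|i IHi] lein.
    exists [set a | c a != 0]; split=> //; first by exists a0; rewrite inE.
      by move=> a; rewrite inE.
    suff -> : \sum_(a in [set a | c a != 0]) c a *: tail 0%N a = 0.
      by have [idP _] := primeP 0%N (leq0n n); apply: ideal0.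
    rewrite -[RHS]rel0 [RHS](bigID (fun a => c a != 0)) /=.
    rewrite [X in _ = _ + X]big1 ?addr0 => [|a]; last first.
      by move/negPn/eqP->; rewrite scale0r.
    by apply: eq_bigl => a; rewrite inE.
  have [A [[a1 a1A] cA agree sumP]] := IHi (ltnW lein).
  pose oi := Ordinal lein.
  (* a has the least exponent of f i, and the terms that share it survive. *)
  have [a /= aA amin] := @arg_minnP _ a1 (mem A) (fun a => a oi) a1A.
  exists [set b in A | b oi == a oi]; split.
  - by exists a; rewrite inE aA eqxx.
  - by move=> b; rewrite inE => /andP[/cA].
  - move=> b d; rewrite !inE => /andP[bA /eqP ba] /andP[dA /eqP da] j.
    rewrite ltnS leq_eqVlt => /orP[/eqP ji|]; last exact: agree.
    by have -> : j = oi by [apply: val_inj]; rewrite ba da.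
  have [idP prP] := primeP i (ltnW lein).
  have [idPS prPS] := primeP i.+1 lein.
  have [fiPS fiP] := fP i lein.
  have tailS b : tail i b = f i ^+ b oi * tail i.+1 b.
    rewrite /tail (bigD1 oi) //=; congr (_ * _); apply: eq_bigl => j.
    by rewrite ltn_neqAle eq_sym andbC; congr (_ && _).
  have : f i ^+ a oi *
      (\sum_(b in A) c b *: (f i ^+ (b oi - a oi) * tail i.+1 b)) \in P i.
    rewrite mulr_sumr (eq_bigr (fun b => c b *: tail i b)) // => b bA.
    by rewrite -scalerAr mulrA -exprD subnKC ?tailS //; apply: amin.
  case/prP/orP => [/(prime_exp idP prP)|/(subP i lein)].
    by rewrite (negPf fiP).
  rewrite (bigID (fun b : {ffun 'I_n -> 'I_B} => b oi == a oi)) /=.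
  rewrite idealDl //.
    rewrite (eq_bigr (fun b => c b *: tail i.+1 b)) => [|b /andP[_ /eqP->]].
      by move=> lowP; under eq_bigl => b do rewrite inE.
    by rewrite subnn expr0 mul1r.
  apply: ideal_sum => // b /andP[bA nba].
  have ltab : (a oi < b oi)%N by rewrite ltn_neqAle eq_sym nba; apply: amin.
  rewrite -(prednK (n := b oi - a oi)) ?subn_gt0 // exprSr mulrAC scalerAl.
  exact: idealMl.
have -> : A = [set a].
  apply/setP => b; rewrite inE; apply/idP/eqP => [bA|->//].
  by apply/ffunP => j; apply: agree.
have [idP _] := primeP n (leqnn n).
rewrite big_set1 /tail big1 => [|j]; last by rewrite leqNgt ltn_ord.
move/(idealMl idP (c a)^-1%:A).
rewrite -scalerAl mul1r scalerA mulVf ?cA // scale1r.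
by rewrite (negPf (ideal1 idP)).
Qed.

Lemma prime_chain_dim (K : fieldType) (N l : nat) (P : {pred {mpoly K[N]}}) :
  prime_chain P l -> (l <= N)%N.
Proof.
case=> chain [prime_c strict_c _]; rewrite leqNgt; apply/negP => ltNl.
(* The condition i < l inside the existential makes f total on nat. *)
have fP i : exists f, (i < l)%N -> f \in chain i.+1 /\ f \notin chain i.
  case: (ltnP i l) => [/strict_c[_ [f f1 f2]]|_]; last by exists 0.
  by exists f.
have [f {}fP] := boolp.choice fP.
have [B [c [[a ca] rel0]]] := algebraic_dependence (fun i : 'I_N.+1 => f i).
move/eqP: ca; apply.
apply: (@prime_chain_alg_indep _ _ _ _ chain f c) => // i ltiN.
- exact/prime_c/(leq_trans ltiN).
- by case: (strict_c i (leq_trans ltiN ltNl)).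
- exact/fP/(leq_trans ltiN).
Qed.

Lemma prime_chain0 (R : comNzRingType) (P : {pred R}) :
  prime_ideal P -> prime_chain P 0.
Proof. by move=> primeP; exists (fun=> P). Qed.

Lemma prime_chainS (R : comNzRingType) (P Q : {pred R}) (l : nat) :
  prime_chain P l -> strict_subset P Q -> prime_ideal Q -> prime_chain Q l.+1.
Proof.
case=> c [prime_c strict_c cP] [PQ [f fQ fP]] primeQ.
exists (fun i => if (i <= l)%N then c i else Q); split.
- by move=> i _; case: ifP => // /prime_c.
- move=> i; rewrite ltnS => il; rewrite il.
  case: ltngtP il => // [il _|-> _]; first exact: strict_c.
  by split=> [g|]; [rewrite cP => /PQ | exists f; rewrite ?cP].
- by rewrite ltnn.
Qed.

(** * Primes generated by variables *)

Section VariableIdeals.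
Variables (K : fieldType) (N : nat).
Implicit Types (T : {set 'I_N}) (P : {pred {mpoly K[N]}}).

Definition kill_vars T : N.-tuple {mpoly K[N]} :=
  [tuple if i \in T then 0 else 'X_i | i < N].

(** The ideal generated by the variables in [T], described as the kernel of
    the substitution of 0 for them: it is then prime because the polynomial
    ring is a domain.  That the variables generate it is
    [var_ideal_sub]. *)
Definition var_ideal T : {pred {mpoly K[N]}} :=
  [pred p | p \mPo kill_vars T == 0].

Lemma var_ideal_prime T : prime_ideal (var_ideal T).
Proof.
split=> [|p q]; last by rewrite !inE rmorphM mulf_eq0.
split=> [||a p q]; rewrite !inE ?rmorph0 // ?rmorph1 ?oner_eq0 //.
by move=> /eqP p0 /eqP q0; rewrite rmorphD rmorphM /= p0 q0 mulr0 addr0.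
Qed.

Lemma mem_var_ideal T i : ('X_i \in var_ideal T) = (i \in T).
Proof.
rewrite inE comp_mpolyXU -tnth_nth tnth_mktuple.
case: ifP => _; first exact: eqxx.
by apply/negbTE; rewrite -msize_poly_eq0 msizeX.
Qed.

(** Modulo an ideal that contains the variables in [T], substituting 0 for
    them changes no polynomial. *)
Lemma var_ideal_sub T P :
  idealr_closed P -> {in T, forall i, 'X_i \in P} -> {subset var_ideal T <= P}.
Proof.
move=> idP TP; suff congT (p : {mpoly K[N]}) : p - (p \mPo kill_vars T) \in P.
  by move=> p; rewrite inE => /eqP pT0; have := congT p; rewrite pT0 subr0.
elim/mpolyind: p => [|c m p _ _ IHp]; first by rewrite raddf0 subr0 ideal0.
rewrite rmorphD /= opprD addrACA idealD //.
rewrite linearZ /= -scalerBr -mul_mpolyC idealMl // comp_mpolyX mpolyXE_id.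
have [/existsP[i /andP[iT mi]]|] := boolP [exists i, (i \in T) && (0 < m i)%N].
  rewrite [X in _ - X](bigD1 i) //= tnth_mktuple iT expr0n eqn0Ngt mi.
  rewrite mul0r subr0.
  by rewrite (bigD1 i) //= -(prednK mi) exprSr mulrAC idealMl ?TP.
rewrite negb_exists => /forallP mT.
rewrite [X in _ - X](eq_bigr (fun i => 'X_i ^+ m i)).
  by rewrite subrr ideal0.
move=> i _; rewrite tnth_mktuple; case: ifP => // iT.
by have := mT i; rewrite iT -eqn0Ngt => /eqP->; rewrite !expr0.
Qed.

(** The ideals generated by the first 0, 1, 2, ... variables of [T] strictly
    increase inside [P]; the last one is replaced by [P] itself, so that the
    chain ends at [P] even when [P] is larger. *)
Lemma prime_chain_vars T P :
  prime_ideal P -> {in T, forall i, 'X_i \in P} -> prime_chain P #|T|.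
Proof.
have [k cardT] := ubnP #|T|; elim: k => // k IHk in T P cardT *.
move=> primeP TP; have [->|[i iT]] := set_0Vmem T.
  by rewrite cards0; apply: prime_chain0.
rewrite (cardsD1 i) iT in cardT *.
apply: (@prime_chainS _ (var_ideal (T :\ i))) => //.
  apply: IHk => //; first exact: var_ideal_prime.
  by move=> j; rewrite mem_var_ideal.
split; last by exists 'X_i; rewrite ?TP // mem_var_ideal !inE eqxx.
by apply: var_ideal_sub => [|j]; [case: primeP | case/setD1P=> _ /TP].
Qed.

Lemma var_ideal_height T : prime_height_is (var_ideal T) #|T|.
Proof.
split=> [|l chain].
  apply: prime_chain_vars => [|i]; first exact: var_ideal_prime.
  by rewrite mem_var_ideal.
(* Adding the remaining variables one by one prolongs the chain up to the
   dimension bound. *)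
suff : (l + #|~: T| <= N)%N.
  by have := cardsC T; rewrite card_ord; lia.
move cardTC: #|~: T| => k; elim: k => [|k IHk] in l T chain cardTC *.
  by rewrite addn0; apply: prime_chain_dim chain.
have [i iT] : exists i, i \in ~: T by apply/card_gt0P; rewrite cardTC.
rewrite addnS -addSn; apply: (IHk _ (i |: T)).
  apply: prime_chainS chain _ (var_ideal_prime _); split.
    apply: var_ideal_sub => [|j jT]; first by case: (var_ideal_prime (i |: T)).
    by rewrite mem_var_ideal !inE jT orbT.
  by exists 'X_i; rewrite mem_var_ideal ?inE ?eqxx // -in_setC.
by move: cardTC; rewrite (cardsD1 i) iT setCU setIC -setDE add1n => -[].
Qed.

End VariableIdeals.

(** * Height from a dominating set and disjoint neighbourhoods *)

(** A prime contains the ideal exactly when it contains a variable from each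
    closed neighbourhood.  The set [D] gives such a prime of height [h], and
    the disjoint neighbourhoods certify that none has smaller height. *)
Lemma height_closed_nbhd_ideal (K : fieldType) (V : finType) (e : rel V)
    (h : nat) (D : {set V}) (u : 'I_h -> V) :
  #|D| = h ->
  (forall v, exists2 w, w \in D & w \in closed_nbhd e v) ->
  (forall i j w,
     w \in closed_nbhd e (u i) -> w \in closed_nbhd e (u j) -> i = j) ->
  height_is (closed_nbhd_ideal K e) h.
Proof.
move=> cardD Ddom udisj; split.
  pose T := [set enum_rank v | v in D].
  have cardT : #|T| = h by rewrite card_imset //; apply: enum_rank_inj.
  exists (var_ideal (K := K) T); split; first exact: var_ideal_prime.
    move=> _ /boolp.asboolP[c ->]; have [idT _] := @var_ideal_prime K _ T.
    apply: ideal_sum => // v _; apply: idealMl => //.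
    have [w wD wv] := Ddom v; rewrite (bigD1 w) //= mulrC idealMl //.
    by rewrite mem_var_ideal imset_f.
  by rewrite -cardT; apply: var_ideal_height.
move=> P k primeP IP [_ maxk]; apply: maxk.
have [idP prP] := primeP.
have /boolp.choice[w wP] i :
    exists w, w \in closed_nbhd e (u i) /\ vertex_var K w \in P.
  suff /(prime_prod idP prP)[w] :
    \prod_(v in closed_nbhd e (u i)) vertex_var K v \in P by exists w.
  apply: IP; apply/boolp.asboolP.
  exists (fun v => (v == u i)%:R); rewrite [RHS](bigD1 (u i)) //= eqxx mul1r.
  by rewrite [X in _ + X]big1 ?addr0 // => v /negPf->; rewrite mul0r.
have -> : h = #|[set enum_rank (w i) | i : 'I_h]|.
  rewrite card_imset ?card_ord // => i j /enum_rank_inj wij.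
  by apply: (udisj i j (w i)); rewrite ?(wP i).1 // wij (wP j).1.
by apply: prime_chain_vars => // _ /imsetP[i _ ->]; exact: (wP i).2.
Qed.

(** * The double broom as a path of layers *)

Section DoubleBroomHeight.
Variables n m s : nat.
Hypotheses (hn : (2 <= n)%N) (hm : (2 <= m)%N) (hs : (2 <= s)%N).

Definition layer (v : dbroom_vertex n m s) : nat :=
  match v with
  | inl (inl _) => 0
  | inl (inr j) => j.+1
  | inr _ => m.+1
  end.

(** Vertices of the same end layer are at distance 2 through [y_1] or [y_m],
    so blowing up the ends of the path creates no exception. *)
Lemma mem_closed_nbhd_dbroom_square u v :
  (v \in closed_nbhd (graph_square (dbroom n m s)) u)
    = (layer u <= layer v + 2)%N && (layer v <= layer u + 2)%N.
Proof.
rewrite !inE graph_square_dbroomE //.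
have ltVgt k (i j : 'I_k) : (i == j) || ((j < i)%N || (i < j)%N).
  by rewrite -neq_ltn eq_sym orbN.
have eqy (j k : 'I_m) : (j == k) = (j == k :> nat) by [].
case: u => [[i|j]|r]; case: v => [[i'|j']|r'] //=.
all: try have := ltn_ord j; try have := ltn_ord j'; try lia.
- by rewrite [LHS]ltVgt.
- rewrite -[inl (inr j') == _]/(j' == j) eqy; lia.
- rewrite -[inr r' == _]/(r' == r) [LHS]ltVgt; lia.
Qed.

Lemma layer_surj p : (p <= m.+1)%N -> exists v, layer v = p.
Proof.
case: p => [_|p]; first by exists (inl (inl (Ordinal (ltnW hn)))).
rewrite ltnS leq_eqVlt => /orP[/eqP->|pm].
  by exists (inr (Ordinal (ltnW hs))).
by exists (inl (inr (Ordinal pm))).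
Qed.

Lemma height_dbroom_square (K : fieldType) :
  height_is (closed_nbhd_ideal K (graph_square (dbroom n m s))) ((m + 6) %/ 5).
Proof.
set h := (_ %/ 5)%N.
(* The bound on p is inside the existential so that pick is total on nat. *)
have surj p : exists v, (p <= m.+1)%N -> layer v = p.
  case: (leqP p m.+1) => [/layer_surj[v]|_]; first by exists v.
  by have [v _] := layer_surj (leq0n _); exists v.
have [pick pickP] := boolp.choice surj.
have lth (k : 'I_h) : (5 * k <= m.+1)%N by have := ltn_ord k; rewrite /h; lia.
(* The cap keeps the last center on the path when fewer than three layers
   remain in the last block of five. *)
pose center (k : 'I_h) := pick (minn (5 * k + 2) m.+1).
have layer_center k : layer (center k) = minn (5 * k + 2) m.+1.
  by rewrite pickP // geq_minr.
apply: (@height_closed_nbhd_ideal _ _ _ h [set center k | k : 'I_h]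
  (fun k : 'I_h => pick (5 * k)%N)).
- rewrite card_imset ?card_ord // => k l /(congr1 layer).
  rewrite !layer_center => kl; apply: val_inj => /=.
  by have := lth k; have := lth l; lia.
- move=> v.
  have lev : (layer v <= m.+1)%N.
    by case: v => [[i|j]|r] //=; rewrite ltnS ltnW.
  have kh : (layer v %/ 5 < h)%N by rewrite /h; lia.
  exists (center (Ordinal kh)); first exact: imset_f.
  by rewrite mem_closed_nbhd_dbroom_square layer_center /=; lia.
- move=> k l w; rewrite !mem_closed_nbhd_dbroom_square !pickP // => kw lw.
  by apply: val_inj => /=; lia.
Qed.

End DoubleBroomHeight.

Lemma absz_ceil_divr (a b : nat) : (0 < b)%N ->
  `|Num.ceil (a%:R / b%:R : rat)|%N = ((a + b.-1) %/ b)%N.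
Proof.
move=> b0; rewrite (@ceil_def _ _ ((a + b.-1) %/ b)%N%:Z) //.
have b0Q : 0 < b%:R :> rat by rewrite ltr0n.
set q := (_ %/ b)%N.
rewrite ltr_pdivlMr // ler_pdivrMr // rmorphB rmorph1 /= mulrBl mul1r ltrBlDr.
rewrite -!pmulrn -!natrM -!natrD ltr_nat ler_nat /q.
have := divn_eq (a + b.-1) b; have := ltn_pmod (a + b.-1) b0; nia.
Qed.

Unset Implicit Arguments.

Theorem theorem4p8 (K : fieldType) (n m s : nat)
    (hn : (2 <= n)%N) (hm : (2 <= m)%N) (hs : (2 <= s)%N) :
  height_is (closed_nbhd_ideal K (graph_square (dbroom n m s)))
            `|Num.ceil ((m + 2)%N%:R / 5%:R : rat)|%N.
Proof.
by rewrite absz_ceil_divr // -addnA; apply: height_dbroom_square.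
Qed.
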